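(* Let $\mathcal{F}$ be the family of finite hypergraphs $H$ such that both $H$ and its dual $H^*$ have VC-dimension at most 2. Then for every integer $r\ge 1$ there is $H\in\mathcal{F}$ all of whose hyperedges have at least $r$ vertices and with $\mathsf{p}(H)=1$; and for every integer $\delta\ge 1$ there is $H\in\mathcal{F}$ in which every vertex has degree at least $\delta$ and with $\mathsf{p}'(H)=1$.
   Context: A hypergraph $H=(V,\mathcal{E})$ has finite vertex set $V$ and a finite multiset $\mathcal{E}$ of subsets of $V$. Its dual $H^*$ has vertex set $\mathcal{E}$ and, for each $v\in V$, a hyperedge $\{E\in\mathcal{E}: v\in E\}$. A set $S\subseteq V$ is shattered if $\{S\cap E: E\in\mathcal{E}\}$ is the set of all subsets of $S$; the VC-dimension is the largest size of a shattered set. A polychromatic $k$-colouring is a map $V\to\{1,\dots,k\}$ such that every hyperedge contains every colour; $\mathsf{p}(H)$ is the maximum such $k$. A set cover is a subfamily of $\mathcal{E}$ with union $V$; $\mathsf{p}'(H)$ is the maximum number of set covers into which $\mathcal{E}$ can be partitioned. *)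

(* Defs.v *)
From HB Require Import structures.
From mathcomp Require Import all_boot.

Set Implicit Arguments.
Unset Strict Implicit.
Unset Printing Implicit Defensive.

(* The multiset of hyperedges is a family of subsets indexed by a finite type,
   so distinct indices may carry the same set. *)
Record hypergraph := Hypergraph {
  vert : finType;
  edge : finType;
  eset : edge -> {set vert}
}.

Definition incident (H : hypergraph) (v : vert H) : {set edge H} :=
  [set e | v \in eset e].

Definition dual (H : hypergraph) : hypergraph := Hypergraph (@incident H).

Definition degree (H : hypergraph) (v : vert H) : nat := #|incident v|.

Definition shattered (H : hypergraph) (S : {set vert H}) : bool :=
  [set S :&: eset e | e : edge H] == powerset S.

(* When H has no hyperedge, no set is shattered and the maximum is 0. *)
Definition vc_dim (H : hypergraph) : nat :=
  \max_(S : {set vert H} | shattered S) #|S|.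

Definition low_vc (H : hypergraph) : Prop :=
  vc_dim H <= 2 /\ vc_dim (dual H) <= 2.

Definition polychromatic (H : hypergraph) (k : nat) (c : vert H -> 'I_k) : Prop :=
  forall (e : edge H) (i : 'I_k), exists2 v, v \in eset e & c v = i.

Definition has_polychromatic (H : hypergraph) (k : nat) : Prop :=
  exists c : vert H -> 'I_k, polychromatic c.

Definition set_cover (H : hypergraph) (C : {set edge H}) : Prop :=
  \bigcup_(e in C) eset e = [set: vert H].

(* The k covers form an indexed family. A cover can be empty only when there are
   no vertices; every k >= 1 is then attained, so that no maximum exists. *)
Definition has_cover_partition (H : hypergraph) (k : nat) : Prop :=
  exists C : 'I_k -> {set edge H},
    [/\ forall i, set_cover (C i),
        forall i j, i != j -> [disjoint C i & C j]
      & \bigcup_(i < k) C i = [set: edge H]].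

Definition is_maximum (P : nat -> Prop) (m : nat) : Prop :=
  P m /\ forall k, P k -> k <= m.

(* p(H) = m and p'(H) = m are relations because the maxima can fail to exist,
   for instance without hyperedges for p and without vertices for p'. *)
Definition p_eq (H : hypergraph) (m : nat) : Prop :=
  is_maximum (has_polychromatic H) m.

Definition p'_eq (H : hypergraph) (m : nat) : Prop :=
  is_maximum (has_cover_partition H) m.

(* Main.v *)
(* Take the complete tree in which every internal node has m + 1 children, with
   internal nodes of depth at most m; the hyperedges are the root-to-leaf paths
   and the sets of children of the internal nodes. If every set of children
   meets every colour, then descending from the root along children of the
   colour of the root produces a monochromatic path, so at most one colour is
   possible. The VC-dimension bounds hold because a path contains all ancestors
   of its nodes, while a set of children is an antichain that meets a path at
   most once and is determined by any of its elements. The second half is the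
   first one applied to the dual hypergraph. *)
Require Import Defs.
From HB Require Import structures.
From mathcomp Require Import all_boot.

Set Implicit Arguments.
Unset Strict Implicit.
Unset Printing Implicit Defensive.

(** * Excluding shattered triples by a missing trace *)

Lemma vc_dim_gt2 (H : hypergraph) : 2 < vc_dim H ->
  exists x y z : vert H, [/\ x != y, y != z & z != x] /\
    forall a b c : bool, exists e : edge H,
      [/\ (x \in eset e) = a, (y \in eset e) = b & (z \in eset e) = c].
Proof.
move=> gt2; have [S /andP[/eqP shS /card_gt2P[x [y [z [[xS yS zS] dist]]]]]] :
    exists S, @shattered H S && (2 < #|S|).
  apply/existsP; apply: contraLR gt2; rewrite negb_exists -leqNgt => /forallP noS.
  by apply/bigmax_leqP => S shS; move: (noS S); rewrite shS -leqNgt.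
exists x, y, z; split=> // a b c; case: dist => xy yz zx.
(* The subset of [S] prescribed by [a], [b], [c]; as [S] is shattered, some edge cuts out exactly
   [T]. *)
pose T := [set v in S | [|| (v == x) && a, (v == y) && b | (v == z) && c]].
have /imsetP[e _ eT] : T \in [set S :&: eset e | e : edge H].
  by rewrite shS powersetE; apply/subsetP => v; rewrite inE => /andP[].
have memE v : v \in S ->
    (v \in eset e) = [|| (v == x) && a, (v == y) && b | (v == z) && c].
  by move=> vS; have := congr1 (fun A : {set _} => v \in A) eT; rewrite !inE vS.
exists e; rewrite !memE // !eqxx !(eq_sym y x) !(eq_sym z y) !(eq_sym x z).
rewrite (negPf xy) (negPf yz) (negPf zx) /=.
by split; rewrite ?orbF.
Qed.

(** * Duality between colourings and cover partitions *)

Lemma vc_dim_dual_dual (H : hypergraph) : vc_dim (dual (dual H)) = vc_dim H.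
Proof.
apply: eq_bigl => S; rewrite /shattered; congr (_ == _).
by apply: eq_imset => e; apply/setP => v; rewrite !inE.
Qed.

Lemma low_vc_dual (H : hypergraph) : low_vc H -> low_vc (dual H).
Proof. by case=> vcH vcD; split; rewrite ?vc_dim_dual_dual. Qed.

(** The covers serve as colour classes: a cover of the dual is a set of vertices meeting every
    hyperedge, and disjointness makes the index chosen for a vertex the only possible one. *)
Lemma has_cover_partition_dual (H : hypergraph) k :
  has_cover_partition (dual H) k -> has_polychromatic H k.
Proof.
case=> C [cov dis tot].
have inC v : exists i, v \in C i.
  have /bigcupP[i _ vi] : v \in \bigcup_(i < k) C i by rewrite tot inE.
  by exists i.
exists (fun v => xchoose (inC v)) => e i.
have /bigcupP[v vi ve] : e \in \bigcup_(v in C i) @eset (dual H) v.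
  by rewrite cov inE.
exists v; first by rewrite inE in ve.
apply/eqP/negPn/negP => /dis /pred0P/(_ v) /=.
by rewrite vi (xchooseP (inC v)).
Qed.

Lemma has_polychromatic_dual (H : hypergraph) k :
  has_polychromatic H k -> has_cover_partition (dual H) k.
Proof.
case=> c cP; exists (fun i => [set v | c v == i]); split=> [i|i j ij|].
- apply/setP => e; rewrite inE; apply/bigcupP.
  by have [v ve cv] := cP e i; exists v; rewrite inE ?cv.
- apply/pred0P => v /=; rewrite !inE; apply/negP => /andP[/eqP ci /eqP cj].
  by rewrite -ci -cj eqxx in ij.
- by apply/setP => v; rewrite inE; apply/bigcupP; exists (c v); rewrite ?inE.
Qed.

Lemma p'_eq_dual (H : hypergraph) m : p_eq H m -> p'_eq (dual H) m.
Proof.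
case=> Pm maxm; split; first exact: has_polychromatic_dual.
by move=> k /has_cover_partition_dual/maxm.
Qed.

Lemma degree_dual (H : hypergraph) (e : edge H) :
  @degree (dual H) e = #|eset e|.
Proof. by apply: eq_card => v; rewrite !inE. Qed.

(** * Comparable prefixes of a word *)

Lemma prefix_le_size (T : eqType) (u v t : seq T) :
  prefix u t -> prefix v t -> size u <= size v -> prefix u v.
Proof.
rewrite !prefixE => /eqP ut /eqP vt uv; apply/eqP.
by rewrite -[in LHS]vt take_takel // ut.
Qed.

Lemma prefix_size_inj (T : eqType) (u v t : seq T) :
  prefix u t -> prefix v t -> size u = size v -> u = v.
Proof. by rewrite !prefixE => /eqP {2}<- /eqP {2}<- ->. Qed.

Lemma prefix_rcons_inv (T : eqType) (v s : seq T) x :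
  prefix v (rcons s x) -> v = rcons s x \/ prefix v s.
Proof.
case/prefixP=> w; case/lastP: w => [|w y]; first by rewrite cats0; left.
by rewrite -rcons_cat => /rcons_inj[-> _]; right; apply: prefix_prefix.
Qed.

(** * The tree hypergraph and its two VC-dimensions *)

Section Tree.
Variable m : nat.

(** A node is the word of child indices leading to it from the root, so ancestors are prefixes;
    words of length at most [m] are internal nodes, those of length [m.+1] are leaves. *)
Definition node := m.+1.-bseq 'I_m.+1.

Definition child (u : m.-bseq 'I_m.+1) (i : 'I_m.+1) : node := [bseq of rcons u i].

Definition tree_edge (e : m.+1.-tuple 'I_m.+1 + m.-bseq 'I_m.+1) : {set node} :=
  match e with
  | inl t => [set v : node | prefix v t]
  | inr u => [set child u i | i : 'I_m.+1]
  end.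

Definition tree : hypergraph := Hypergraph tree_edge.

Lemma size_children u (v : node) : v \in tree_edge (inr u) -> size v = (size u).+1.
Proof. by case/imsetP => i _ ->; rewrite size_rcons. Qed.

Lemma children_inj u u' (v : node) :
  v \in tree_edge (inr u) -> v \in tree_edge (inr u') -> u = u'.
Proof.
case/imsetP => i _ -> /imsetP[j _ /(congr1 val) /= /rcons_inj[uu' _]].
exact: val_inj.
Qed.

Lemma children_path_inj u t (v w : node) :
    v \in tree_edge (inr u) -> w \in tree_edge (inr u) ->
  v \in tree_edge (inl t) -> w \in tree_edge (inl t) -> v = w.
Proof.
move=> /size_children vu /size_children wu; rewrite !inE => vt wt.
by apply/val_inj/(prefix_size_inj vt wt); rewrite /= vu wu.
Qed.

Lemma path_closed t t' (v w : node) :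
    v \in tree_edge (inl t) -> w \in tree_edge (inl t) ->
    w \in tree_edge (inl t') -> size v <= size w ->
  v \in tree_edge (inl t').
Proof.
rewrite !inE => vt wt wt' vw.
exact: prefix_trans (prefix_le_size vt wt vw) wt'.
Qed.

(** An edge with two distinct nodes of a path is itself a path, as a set of children meets a path at
    most once; it then contains all ancestors of [z]. *)
Lemma path_edge_closed t e (x y z : node) :
    x \in tree_edge (inl t) -> y \in tree_edge (inl t) ->
    z \in tree_edge (inl t) -> x != z -> size y <= size z ->
  x \in tree_edge e -> z \in tree_edge e -> y \in tree_edge e.
Proof.
case: e => [t'|u] xt yt zt xz yz xe ze; first exact: path_closed yt zt ze yz.
by rewrite (children_path_inj xe ze xt zt) eqxx in xz.
Qed.

(** Two distinct siblings lie on no common path, so [e] is a set of children, and sharing [x] it is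
    that of [u]. *)
Lemma children_edge_closed u e (x y z : node) :
    x \in tree_edge (inr u) -> y \in tree_edge (inr u) ->
    z \in tree_edge (inr u) -> x != z ->
  x \in tree_edge e -> z \in tree_edge e -> y \in tree_edge e.
Proof.
case: e => [t|u'] xu yu zu xz xe ze; last by rewrite -(children_inj xu xe).
by rewrite (children_path_inj xu zu xe ze) eqxx in xz.
Qed.

Lemma vc_dim_tree : vc_dim tree <= 2.
Proof.
rewrite leqNgt; apply/negP => /vc_dim_gt2[x [y [z [[xy yz zx] pat]]]].
have [/= e [xe ye ze]] := pat true true true.
have [/= e1 [x1 y1 z1]] := pat true false true.
case: e xe ye ze => [t|u] xe ye ze; last first.
  by rewrite (children_edge_closed xe ye ze _ x1 z1) // eq_sym in y1.
have [/= e2 [x2 y2 z2]] := pat false true true.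
(* In each case [x] or [y] is no deeper than another of the three nodes, so an edge with that node
   and the third cannot miss it. *)
have [le_xz|/ltnW le_zx] := leqP (size x) (size z).
  by rewrite (path_edge_closed ye xe ze yz le_xz y2 z2) in x2.
have [le_yx|/ltnW le_xy] := leqP (size y) (size x).
  by rewrite (path_edge_closed ze ye xe zx le_yx z1 x1) in y1.
by rewrite (path_edge_closed ze xe ye _ le_xy z2 y2) // eq_sym in x2.
Qed.

Lemma dual_two_paths t t' u (v w : node) :
    v \in tree_edge (inl t) -> v \in tree_edge (inl t') ->
    v \in tree_edge (inr u) ->
  w \in tree_edge (inl t) -> w \in tree_edge (inr u) -> w \in tree_edge (inl t').
Proof. by move=> vt vt' vu wt wu; rewrite (children_path_inj wu vu wt vt). Qed.

Lemma vc_dim_dual_tree : vc_dim (dual tree) <= 2.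
Proof.
rewrite leqNgt; apply/negP => /vc_dim_gt2[x [y [z [[xy yz zx] pat]]]].
have {}pat a b c : exists v : node,
    [/\ (v \in tree_edge x) = a, (v \in tree_edge y) = b
      & (v \in tree_edge z) = c].
  by have [v [<- <- <-]] := pat a b c; exists v; rewrite !inE.
have [v [vx vy vz]] := pat true true true.
have [v1 [x1 y1 z1]] := pat false true true.
have [v2 [x2 y2 z2]] := pat true false true.
have [v3 [x3 y3 z3]] := pat true true false.
(* Two sets of children sharing [v] coincide, and a single one meets each path through [v] only in
   [v]. The case of three paths compares depths. *)
case: x y z xy yz zx vx vy vz x1 y1 z1 x2 y2 z2 x3 y3 z3 {pat}
  => [tx|ux] [ty|uy] [tz|uz] xy yz zx vx vy vz x1 y1 z1 x2 y2 z2 x3 y3 z3.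
(* Both [v1] and [v2] lie on the path [tz], so one is a prefix of the other and lies on all three
   paths. *)
- have [le12|/ltnW le21] := leqP (size v1) (size v2).
    by rewrite (path_closed z1 z2 x2 le12) in x1.
  by rewrite (path_closed z2 z1 y1 le21) in y2.
- by rewrite (dual_two_paths vx vy vz x2 z2) in y2.
- by rewrite (dual_two_paths vx vz vy x3 y3) in z3.
- by rewrite (children_inj vy vz) eqxx in yz.
- by rewrite (dual_two_paths vy vz vx y3 x3) in z3.
- by rewrite (children_inj vx vz) eqxx in zx.
- by rewrite (children_inj vx vy) eqxx in xy.
- by rewrite (children_inj vx vy) eqxx in xy.
Qed.

(** * Edge sizes and colourings of the tree *)

Lemma card_tree_edge (e : edge tree) : m < #|eset e|.
Proof.
case: e => [t|u] /=; last first.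
  rewrite card_imset ?card_ord // => i j /(congr1 val) /=.
  by case/rcons_inj.
have le_t (i : 'I_m.+2) : i <= size t by rewrite size_tuple -ltnS.
pose anc (i : 'I_m.+2) : node := take_bseq i (bseq_of_tuple t).
have anc_inj : injective anc.
  move=> i j /(congr1 (fun v : node => size v)) /=.
  by rewrite !size_takel ?le_t // => /val_inj.
(* The prefixes of lengths 0 to [m.+1] give a path [m.+2] nodes, one more than required. *)
apply: ltnW; rewrite -[leqLHS]card_ord -(card_imset _ anc_inj).
apply/subset_leq_card/subsetP => _ /imsetP[i _ ->].
by rewrite inE prefixE /= size_takel ?le_t.
Qed.

Lemma monochromatic_branch k (c : node -> 'I_k) (d : nat) :
    @polychromatic tree k c -> d <= m.+1 ->
  exists2 s : seq 'I_m.+1, size s = d &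
    forall v : node, prefix v s -> c v = c [bseq].
Proof.
move=> cP; elim: d => [_|d IHd ltd].
  exists [::] => // v; rewrite prefixs0 => /eqP v0.
  by congr c; apply: val_inj.
have [s sd mono] := IHd (ltnW ltd).
have les : size s <= m by rewrite sd.
(* Having length at most [m], the node [s] is internal, so one of its children has the colour of the
   root [[bseq]]. *)
have [/= _ /imsetP[i _ ->] ci] := cP (inr (Bseq les)) (c [bseq]).
exists (rcons s i) => [|v]; first by rewrite size_rcons sd.
case/prefix_rcons_inv=> [vs|/mono//].
by rewrite -ci; congr c; apply: val_inj.
Qed.

Lemma p_eq_tree : p_eq tree 1.
Proof.
split=> [|k [c cP]].
  exists (fun=> ord0) => e i; rewrite (ord1 i).
  by have /card_gt0P[v ve] := leq_ltn_trans (leq0n m) (card_tree_edge e); exists v.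
(* At depth [m.+1] the branch is a whole root-to-leaf path, hence an edge on which only the colour
   of the root occurs. *)
have [s /eqP ss mono] := monochromatic_branch cP (leqnn _).
have allc i : i = c [bseq].
  by have [v] := cP (inl (Tuple ss)) i; rewrite inE => /mono-> ->.
rewrite -(card_ord k); apply/card_le1P => i _ j.
by rewrite !inE (allc i) (allc j) eqxx.
Qed.

End Tree.

Theorem theorem7 :
  (forall r : nat, 1 <= r ->
     exists H : hypergraph,
       [/\ low_vc H,
           forall e : edge H, r <= #|eset e|
         & p_eq H 1]) /\
  (forall delta : nat, 1 <= delta ->
     exists H : hypergraph,
       [/\ low_vc H,
           forall v : vert H, delta <= degree v
         & p'_eq H 1]).
Proof.
have low_tree m : low_vc (tree m).
  by split; [exact: vc_dim_tree | exact: vc_dim_dual_tree].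
split=> [r _|d _].
  by exists (tree r); split=> // [e|]; [exact/ltnW/card_tree_edge|exact: p_eq_tree].
exists (dual (tree d)); split; first exact: low_vc_dual.
  by move=> e; rewrite degree_dual; exact/ltnW/card_tree_edge.
exact/p'_eq_dual/p_eq_tree.
Qed.
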